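(* Let $\pi\colon\mathbb{R}_+\times X\to X$ be a $C^0$-semiflow on a non-singleton Polish space $X$. If it is topologically weakly-mixing, then it is densely multi-dimensional Li-Yorke chaotic.
   Context: Let $T=(\mathbb{R}_+,+)$, $\mathbb{R}_+=[0,\infty)$, with the usual topology. A $C^0$-semiflow is a jointly continuous map $\pi\colon T\times X\to X$, $(t,x)\mapsto tx:=\pi(t,x)$, with $\pi(s,\pi(t,x))=\pi(s+t,x)$ and $\pi(0,x)=x$. $T$ acts on $X^k$ by $t(x_1,\dots,x_k)=(tx_1,\dots,tx_k)$. For nonempty open $U,V\subseteq X$ let $N_T(U,V)=\{t\in T : U\cap t^{-1}V\neq\emptyset\}$, $t^{-1}V=\{x : tx\in V\}$. The semiflow is topologically weakly-mixing if $N_T(U,V)\cap N_T(U',V')\neq\emptyset$ for all nonempty open $U,V,U',V'\subseteq X$ (equivalently, $(T,X\times X)$ is topologically transitive). The semiflow is densely multi-dimensional Li-Yorke chaotic if for every increasing sequence $\{F_n\}_{n\ge1}$ of compact subsets of $T$ there is an uncountable dense set $\Theta\subseteq X$ such that for any $k\ge2$ and any distinct $x_1,\dots,x_k\in\Theta$ there are sequences $\{s_n\},\{t_n\}$ in $T$ and a point $p\in X$ with $s_n\notin F_n$ for all $n$, $s_n(x_1,\dots,x_k)\to(x_1,\dots,x_k)$ and $t_n(x_1,\dots,x_k)\to(p,\dots,p)$ as $n\to\infty$. *)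

(* Defs.v *)
From mathcomp Require Import all_boot all_order all_algebra.
From mathcomp Require Import all_classical all_reals all_analysis.

Set Implicit Arguments.
Unset Strict Implicit.
Unset Printing Implicit Defensive.

Import Order.TTheory GRing.Theory Num.Theory.
Import numFieldNormedType.Exports.

Local Open Scope classical_set_scope.
Local Open Scope ring_scope.

Definition is_metric (R : realType) (X : Type) (d : X -> X -> R) : Prop :=
  [/\ forall x y, 0 <= d x y,
      forall x y, d x y = 0 <-> x = y,
      forall x y, d x y = d y x &
      forall x y z, d x z <= d x y + d y z].

Definition metric_induces_topology (R : realType) (X : topologicalType)
    (d : X -> X -> R) : Prop :=
  forall (x : X) (A : set X),
    nbhs x A <-> exists2 e : R, 0 < e & [set y | d x y < e] `<=` A.

Definition complete_metric (R : realType) (X : topologicalType)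
    (d : X -> X -> R) : Prop :=
  forall u : nat -> X,
    (forall e : R, 0 < e ->
       exists N : nat, forall m n : nat,
         (N <= m)%N -> (N <= n)%N -> d (u m) (u n) < e) ->
    exists l : X, u @ \oo --> l.

Definition separable (X : topologicalType) : Prop :=
  exists D : set X, countable D /\ dense D.

Definition polish (R : realType) (X : topologicalType) : Prop :=
  separable X /\
  exists d : X -> X -> R,
    [/\ is_metric d, metric_induces_topology d & complete_metric d].

(* The time monoid [0, +oo[, as a subset of R.  A map on [0, +oo[ * X is
   represented by a function pi : R -> X -> X, whose values at negative times
   are unconstrained and never used. *)
Definition times (R : realType) : set R := [set t : R | 0 <= t].
Arguments times : clear implicits.

Definition C0_semiflow (R : realType) (X : topologicalType)
    (pi : R -> X -> X) : Prop :=
  [/\ {within times R `*` [set: X], continuous (fun p : R * X => pi p.1 p.2)},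
      forall (s t : R) (x : X),
        times R s -> times R t -> pi s (pi t x) = pi (s + t) x &
      forall x : X, pi 0 x = x].

Definition hitting_times (R : realType) (X : topologicalType)
    (pi : R -> X -> X) (U V : set X) : set R :=
  [set t : R | times R t /\ U `&` (pi t @^-1` V) !=set0].

Definition weakly_mixing (R : realType) (X : topologicalType)
    (pi : R -> X -> X) : Prop :=
  forall U V U' V' : set X,
    open U -> open V -> open U' -> open V' ->
    U !=set0 -> V !=set0 -> U' !=set0 -> V' !=set0 ->
    hitting_times pi U V `&` hitting_times pi U' V' !=set0.

(* {ptws 'I_k -> X} is X^k with the product topology. *)
Definition power_flow (R : realType) (X : topologicalType)
    (pi : R -> X -> X) (k : nat) (t : R) (x : {ptws 'I_k -> X}) :
    {ptws 'I_k -> X} :=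
  fun i => pi t (x i).

Definition multi_Li_Yorke_tuple (R : realType) (X : topologicalType)
    (pi : R -> X -> X) (F : nat -> set R) (k : nat)
    (x : {ptws 'I_k -> X}) : Prop :=
  exists (s t : nat -> R) (p : X),
    [/\ forall n, times R (s n) /\ ~ F n (s n),
        forall n, times R (t n),
        (fun n => power_flow pi (s n) x) @ \oo --> x &
        (fun n => power_flow pi (t n) x) @ \oo -->
          ((fun=> p) : {ptws 'I_k -> X})].

Definition densely_multi_Li_Yorke_chaotic (R : realType) (X : topologicalType)
    (pi : R -> X -> X) : Prop :=
  forall F : nat -> set R,
    (forall n, F n `<=` times R) ->
    (forall n, compact (F n)) ->
    (forall n, F n `<=` F n.+1) ->
    exists Theta : set X,
      [/\ ~ countable Theta,
          dense Theta &
          forall (k : nat) (x : {ptws 'I_k -> X}),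
            (2 <= k)%N -> injective x -> (forall i, Theta (x i)) ->
            multi_Li_Yorke_tuple pi F x].

(* Main.v *)
Require Import Defs.
From mathcomp Require Import all_boot all_order all_algebra.
From mathcomp Require Import all_classical all_reals all_analysis.

Import Order.TTheory GRing.Theory Num.Theory.
Import numFieldNormedType.Exports.

Local Open Scope classical_set_scope.
Local Open Scope ring_scope.

(** Weak mixing says that two sets of hitting times N(U, V) always meet. The
maps of the semiflow commute, so a time common to N(U, U') and N(V, V') yields
open sets U1 in U and V1 in V with N(U1, V1) contained both in N(U, V) and in
N(U', V') (hitting_times_sub). Hence the sets N(U, V) generate a proper filter.
A compact set F of times never belongs to it: the filter would cluster at some
t in F, and continuity of the semiflow at (t, x) would force
t x = z for all x and z (hitting_filter_compact). With a countable pi-base one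
can therefore choose times t_n outside F_n such that every N(U, V) contains all
but finitely many t_n (meeting_times).

From then on only the sequence of continuous maps f_n = pi(t_n, .) matters.
Fix a point p. It is enough to find a dense uncountable set all of whose finite
subsets L satisfy: some subsequence of f tends to the identity on L, and some
subsequence tends to p on L. The first gives recurrence, at times that avoid
the F_n because the F_n increase; the second gives the collapse to (p, ..., p).
Both conditions are instances of tracking a countable family of continuous maps
c_i (tracks).

If a finite set L already tracks c_i, then for each N the points y such that
some f_n with N <= n is 1/(N+1)-close to c_i on L and at y form a dense open
set: the indices n that serve L are unbounded, while all large f_n carry a
point near y to a point near c_i(y) (dense_tracking_point). By Baire's theorem
a countable tracking set can be enlarged by a new point in any given nonempty
open set (tracks_extend). Iterating this through a pi-base gives a dense
tracking set, and Zorn's lemma a maximal one above it; being maximal, it is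
uncountable (dense_uncountable_tracking). This replaces the usual construction
of a Mycielski set by a tree of open sets. *)

(** * Countable sets and unions of chains *)

Lemma countable_enumeration {T : Type} {A : set T} :
  countable A -> A !=set0 -> exists e : nat -> T, range e = A.
Proof.
move=> /countable_injP[g g_inj] [a0 Aa0].
have /choice[e eP] n : exists a, A a /\ forall b, A b -> g b = n -> a = b.
  have [[b [Ab gb]]|nob] := pselect (exists b, A b /\ g b = n).
    exists b; split=> // b' Ab' gb'; apply: g_inj; rewrite ?in_setE//.
    by rewrite gb gb'.
  by exists a0; split=> // b Ab gb; case: nob; exists b.
exists e; apply/seteqP; split=> [_ [n _ <-]|a Aa]; first by case: (eP n).
by exists (g a) => //; case: (eP (g a)) => _; apply.
Qed.

Lemma invS_lt {R : realType} (e : R) : 0 < e -> exists n : nat, n.+1%:R^-1 < e.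
Proof. by move=> /ltr_add_invr[n]; rewrite add0r; exists n. Qed.

Lemma invS_le {R : realType} {m n : nat} :
  (m <= n)%N -> n.+1%:R^-1 <= m.+1%:R^-1 :> R.
Proof. by move=> mn; rewrite lef_pV2 ?posrE ?ler_nat. Qed.

Lemma countableU {T : Type} {A B : set T} :
  countable A -> countable B -> countable (A `|` B).
Proof.
move=> cA cB; rewrite -bigcup2E; apply: bigcup_countable => // i _.
by rewrite /bigcup2; case: ifP => // _; case: ifP.
Qed.

(** A finite set reaches only finitely many members of the chain F, and the
largest of these contains the others. The set D allows chains of sets above a
fixed one, including the empty chain. *)
Lemma finite_sub_chain {T : choiceType} {D : set T} {F : set (set T)}
    {L : set T} :
  total_on F subset -> finite_set L -> L `<=` D `|` \bigcup_(A in F) A ->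
  L `<=` D \/ exists2 A, F A & L `<=` D `|` A.
Proof.
move=> F_total /finite_seqP[s ->]; elim: s => [|x s IHs] sub; first by left.
have sub_s : [set` s] `<=` D `|` \bigcup_(A in F) A.
  by move=> y /= ys; apply: sub; rewrite /= in_cons ys orbT.
have cover B : B x -> [set` s] `<=` B -> [set` x :: s] `<=` B.
  by move=> Bx sB y; rewrite /= in_cons => /orP[/eqP->|/sB].
case: (sub x) => [|Dx|[A FA Ax]]; first by rewrite /= mem_head.
  case: (IHs sub_s) => [sD|[B FB sB]]; first by left; exact: cover.
  by right; exists B => //; apply: cover => //; left.
right; case: (IHs sub_s) => [sD|[B FB sB]].
  by exists A => //; apply: cover => //; [right|move=> y /sD; left].
have [AB|BA] := F_total _ _ FA FB.
  by exists B => //; apply: cover => //; right; exact: AB.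
exists A => //; apply: cover => //; first by right.
by move=> y /sB[|/BA]; [left|right].
Qed.

(** * Baire's theorem for a topology given by a complete metric *)

Section MetricTopology.
Context {R : realType} {X : topologicalType} {d : X -> X -> R}.
Hypotheses (d_metric : is_metric d) (d_top : metric_induces_topology d).

Let dxx x : d x x = 0. Proof. by case: d_metric => _ /(_ x x)[_ ->]. Qed.
Let dC x y : d x y = d y x. Proof. by case: d_metric. Qed.
Let d_triangle y {x z} : d x z <= d x y + d y z. Proof. by case: d_metric. Qed.

Lemma open_metric_ball x e : open [set y | d x y < e].
Proof.
rewrite openE => y /= xy; rewrite /interior; apply/d_top.
exists (e - d x y); first by rewrite subr_gt0.
by move=> z /=; rewrite ltrBrDl; apply: le_lt_trans; exact: d_triangle.
Qed.

Lemma metric_ball_center x e : 0 < e -> [set y | d x y < e] x.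
Proof. by rewrite /= dxx. Qed.

Lemma open_metric_ball_sub {U x} : open U -> U x ->
  exists2 e, 0 < e & [set y | d x y < e] `<=` U.
Proof. by rewrite openE => oU /oU /d_top. Qed.

Lemma cvg_metricP (u : nat -> X) l :
  (forall e, 0 < e -> \forall n \near \oo, d l (u n) < e) <-> u @ \oo --> l.
Proof.
split=> [ul A /d_top[e e0 eA]|ul e e0]; last first.
  apply: (ul [set y | d l y < e]); apply/d_top; by exists e.
by near=> n; apply: eA; near: n; exact: ul.
Unshelve. all: by end_near. Qed.

(** Nested closed balls with radii at most 1/(n+1), the n-th one inside O n: the
centers form a Cauchy sequence, and its limit lies in all the balls. *)
Lemma baire_metric_seq (O : nat -> set X) : complete_metric d ->
  (forall n, open (O n)) -> (forall n, dense (O n)) ->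
  dense (\bigcap_n O n).
Proof.
move=> d_complete oO dO U [x0 Ux0] oU.
pose cball (c : X * R) := [set y | d c.1 y <= c.2].
have /choice[g gP] (p : nat * (X * R)) : exists c' : X * R, 0 < p.2.2 ->
    [/\ 0 < c'.2, c'.2 <= p.1.+1%:R^-1 & cball c' `<=` cball p.2 `&` O p.1].
  case: p => n [x r]; have [r0|] := ltP 0 r; last by exists (x, r).
  have [y [/= xy Oy]] : [set y | d x y < r] `&` O n !=set0.
    apply: dO; last exact: open_metric_ball.
    by exists x; exact: metric_ball_center.
  have [e e0 eO] := open_metric_ball_sub (oO n) Oy.
  (* e / 2 instead of e because the new ball is closed; r - d x y keeps it
     inside the previous ball. *)
  pose r' : R := Num.min (Num.min (e / 2) (r - d x y)) n.+1%:R^-1.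
  exists (y, r') => _; split=> /=.
  - by rewrite !lt_min !divr_gt0// subr_gt0 xy invr_gt0 ltr0n.
  - by rewrite ge_min lexx orbT.
  move=> z /=; rewrite /cball /= !le_min => /andP[/andP[ze zr] _]; split.
    by apply: le_trans (d_triangle y) _; rewrite -lerBrDl.
  apply: eO => /=; apply: le_lt_trans ze _.
  by rewrite ltr_pdivrMr// ltr_pMr// ltr1n.
have [r r0 rU] := open_metric_ball_sub oU Ux0.
pose q := fix q n := if n is m.+1 then g (m, q m) else (x0, r / 2).
have q_pos n : 0 < (q n).2.
  elim: n => [|n IHn] /=; first by rewrite divr_gt0.
  by case: (gP (n, q n) IHn).
have qS n : (q n.+1).2 <= n.+1%:R^-1 /\ cball (q n.+1) `<=` cball (q n) `&` O n.
  by case: (gP (n, q n) (q_pos n)).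
have q_nested m n : (m <= n)%N -> cball (q n) `<=` cball (q m).
  move=> /subnK <-; elim: (n - m)%N => [//|k IHk] y; rewrite addSn.
  by move=> /(proj2 (qS _))[/IHk].
have q_center m n : (m <= n)%N -> cball (q m) (q n).1.
  by move=> /q_nested; apply; rewrite /cball /= dxx ltW.
have [l ul] : exists l : X, (fun n => (q n).1) @ \oo --> l.
  apply: (d_complete (fun n => (q n).1)) => e e0.
  have [N Ne] : exists N : nat, N.+1%:R^-1 < e / 2.
    by apply: invS_lt; rewrite divr_gt0.
  exists N.+1 => m n mN nN; rewrite (splitr e).
  apply: le_lt_trans (d_triangle (q N.+1).1) _; rewrite dC.
  have rN : (q N.+1).2 < e / 2 by apply: le_lt_trans Ne; case: (qS N).
  by apply: ltrD; apply: le_lt_trans rN; exact: q_center.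
have lq n : cball (q n) l.
  apply/ler_addgt0Pr => e e0.
  move/cvg_metricP : ul => /(_ e e0)[N _ Nl].
  have := Nl (maxn N n) (leq_maxl _ _); rewrite /= dC => /ltW ml.
  apply: le_trans (d_triangle (q (maxn N n)).1) _; apply: lerD => //.
  by apply: q_center; exact: leq_maxr.
exists l; split=> [|n _]; last by case: ((qS n).2 _ (lq n.+1)).
apply: rU; rewrite /= (le_lt_trans (lq 0%N))//=.
by rewrite ltr_pdivrMr// ltr_pMr// ltr1n.
Qed.

Lemma baire_metric {F : set (set X)} : complete_metric d -> countable F ->
  (forall O, F O -> open O /\ dense O) -> dense (\bigcap_(O in F) O).
Proof.
move=> d_complete cF odF; have [->|/set0P F0] := eqVneq F set0.
  by rewrite bigcap_set0 => U U0 _; rewrite setIT.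
have [G GE] := countable_enumeration cF F0; rewrite -GE bigcap_image.
have odG n : open (G n) /\ dense (G n) by apply: odF; rewrite -GE; exists n.
by apply: baire_metric_seq => // n; case: (odG n).
Qed.

(** The balls of radius 1/(m+1) around the points of a countable dense set. *)
Lemma countable_pi_base : separable X -> [set: X] !=set0 ->
  exists B : nat -> set X,
    [/\ forall i, open (B i), forall i, B i !=set0 &
        forall U, open U -> U !=set0 -> exists i, B i `<=` U].
Proof.
move=> [D [cD dD]] X0.
have [|e eD] := countable_enumeration cD.
  by have [a [_ Da]] := dD _ X0 openT; exists a.
have /countable_enumeration[|b b_range] : countable [set: nat * nat].
- exact: countableP.
- by exists (0, 0)%N.
exists (fun k => [set y | d (e (b k).1) y < (b k).2.+1%:R^-1]); split.
- by move=> k; exact: open_metric_ball.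
- move=> k; exists (e (b k).1); apply: metric_ball_center.
  by rewrite invr_gt0 ltr0n.
move=> U oU [x Ux]; have [r r0 rU] := open_metric_ball_sub oU Ux.
have [m mr] : exists m : nat, m.+1%:R^-1 < r / 2.
  by apply: invS_lt; rewrite divr_gt0.
have [a [/= xa]] : [set y | d x y < m.+1%:R^-1] `&` D !=set0.
  apply: dD; last exact: open_metric_ball.
  by exists x; apply: metric_ball_center; rewrite invr_gt0 ltr0n.
rewrite -eD => -[i _ ea].
have [k _ bk] : range b (i, m) by rewrite b_range.
exists k => y /=; rewrite bk /= ea => ay; apply: rU => /=.
apply: le_lt_trans (d_triangle a) _; rewrite (splitr r).
by apply: ltrD; [exact: lt_trans mr|exact: lt_trans mr].
Qed.

End MetricTopology.

(** * Finite sets tracked by a sequence of maps *)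

(** The sequence f acts like a mixing system. Every subsequence has the same
property, which is what allows points to be added one at a time. *)
Definition eventually_meeting {X : topologicalType} (f : nat -> X -> X) :
    Prop :=
  forall U V : set X, open U -> open V -> U !=set0 -> V !=set0 ->
  \forall n \near \oo, U `&` (f n @^-1` V) !=set0.

(** For each target map c i and each finite subset L of A, some subsequence of
f converges to c i at all the points of L; N bounds both the index from below
and the error from above. The condition only looks at finite subsets, so it
passes to unions of chains. *)
Definition tracks {R : realType} {X : topologicalType} (d : X -> X -> R)
    (f : nat -> X -> X) {I : Type} (c : I -> X -> X) (A : set X) : Prop :=
  forall (i : I) (L : set X), finite_set L -> L `<=` A -> forall N : nat,
  exists2 n, (N <= n)%N & forall x, L x -> d (c i x) (f n x) < N.+1%:R^-1.

Section Tracking.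
Context {R : realType} {X : topologicalType} {d : X -> X -> R}.
Context {f : nat -> X -> X} {I : countType} {c : I -> X -> X}.

Lemma tracks_set0 : tracks d f c set0.
Proof. by move=> i L _ L0 N; exists N => // x /L0. Qed.

(** The chain condition of Zorn's lemma, above a fixed set D. *)
Lemma tracks_chain (D : set X) (F : set (set X)) : total_on F subset ->
  tracks d f c D -> (forall A, F A -> tracks d f c (D `|` A)) ->
  tracks d f c (D `|` \bigcup_(A in F) A).
Proof.
move=> F_total tD tF i L L_fin LF.
have [LD|[A FA LA]] := finite_sub_chain F_total L_fin LF.
  exact: tD.
exact: tF LA.
Qed.

Hypotheses (d_metric : is_metric d) (d_top : metric_induces_topology d).
Hypotheses (d_complete : complete_metric d) (X_separable : separable X).
Hypotheses (X_two : exists x y : X, x <> y).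
Hypotheses (f_continuous : forall n, continuous (f n)).
Hypotheses (c_continuous : forall i, continuous (c i)).
Hypothesis f_meeting : eventually_meeting f.

(** X has no isolated point: if {a} were open, f n a would have to equal a, and
also to differ from a, for all large n. *)
Lemma dense_setC1 (a : X) : open (~` [set a]) /\ dense (~` [set a]).
Proof.
have sep x y : x <> y -> exists2 r, 0 < r & ~ d x y < r.
  move=> xy; exists (d x y); last by rewrite ltxx.
  case: d_metric => d0 dE _ _; rewrite lt_neqAle d0 andbT eq_sym.
  by apply/eqP => /dE.
have oC (x : X) : open (~` [set x]).
  rewrite openE => y /= yx; rewrite /interior; apply/d_top.
  have [r r0 nr] := sep _ _ yx.
  by exists r => // z yz zx; apply: nr; rewrite -zx.
split=> // U U0 oU; apply: contrapT => Ua.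
have Uax x : U x -> x = a.
  by move=> Ux; apply: contrapT => xa; apply: Ua; exists x.
have {U0} U_a : U a by case: U0 => x Ux; rewrite -(Uax _ Ux).
have [b ba] : exists b, b <> a.
  case: X_two => x [y xy]; have [xa|xa] := pselect (x = a); last by exists x.
  by exists y => ya; apply: xy; rewrite xa.
have Va : (~` [set a]) !=set0 by exists b.
have UU := f_meeting _ _ oU oU (ex_intro _ a U_a) (ex_intro _ a U_a).
have UV := f_meeting _ _ oU (oC a) (ex_intro _ a U_a) Va.
have [n _ /(_ n (leqnn n)) [[x [/Uax -> /Uax fa]] [y [/Uax -> /= nfa]]]] :=
  filterI UU UV.
exact: nfa.
Qed.

Lemma open_metric_lt (g h : X -> X) :
  continuous g -> continuous h -> forall e, open [set x | d (g x) (h x) < e].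
Proof.
move=> cg ch e; rewrite openE => x /= xe; rewrite /interior.
pose r := (e - d (g x) (h x)) / 2.
have r0 : 0 < r by rewrite divr_gt0// subr_gt0.
have ng : nbhs x (g @^-1` [set y | d (g x) y < r]).
  by apply: cg; apply/d_top; exists r.
have nh : nbhs x (h @^-1` [set y | d (h x) y < r]).
  by apply: ch; apply/d_top; exists r.
apply: filterS (filterI ng nh) => y [/= gy hy].
case: d_metric => _ _ dC dT.
apply: le_lt_trans (dT _ (g x) _) _; rewrite dC.
apply: le_lt_trans (lerD (lexx _) (dT _ (h x) _)) _.
have -> : e = r + (d (g x) (h x) + r) by rewrite addrCA -splitr subrKC.
by rewrite ltrD// ltrD2l.
Qed.

(** Near any point y0 the set contains a point y: large f n carry some y close
to y0 to a point close to c i y0, which is close to c i y, and among these n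
there is one that serves L. *)
Lemma dense_tracking_point (A L : set X) (i : I) (N : nat) :
  tracks d f c A -> finite_set L -> L `<=` A ->
  let O := [set y | exists2 n, (N <= n)%N &
    forall x, (y |` L) x -> d (c i x) (f n x) < N.+1%:R^-1] in
  open O /\ dense O.
Proof.
move=> tA L_fin LA O; split.
  rewrite openE => y [n Nn yn].
  have oy :=
    open_metric_lt _ _ (c_continuous i) (f_continuous n) N.+1%:R^-1.
  have := open_nbhs_nbhs (conj oy (yn y (or_introl erefl))).
  apply: filterS => z /= zn; exists n => // x [->//|Lx].
  by apply: yn; right.
move=> U [y0 Uy0] oU.
set e : R := N.+1%:R^-1; have e0 : 0 < e by rewrite invr_gt0 ltr0n.
pose V := [set z | d (c i y0) z < e / 2].
have oV : open V by exact: open_metric_ball.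
have Vc : V (c i y0).
  by apply: metric_ball_center => //; rewrite divr_gt0.
pose W := U `&` (c i @^-1` V).
have oW : open W.
  by apply: openI => //; apply: open_comp => // x _; exact: c_continuous.
have [M _ Mf] :=
  f_meeting W V oW oV (ex_intro _ y0 (conj Uy0 Vc)) (ex_intro _ _ Vc).
have [n nMN Ln] := tA i L L_fin LA (maxn M N).
have [Mn Nn] : (M <= n)%N /\ (N <= n)%N.
  by move: nMN; rewrite geq_max => /andP.
have [y [[Uy /= cy] /= fy]] := Mf n Mn.
exists y; split=> //; exists n => // x [->|Lx].
  case: d_metric => _ _ dC dT; rewrite -/e (splitr e).
  by apply: le_lt_trans (dT _ (c i y0) _) _; rewrite dC; exact: ltrD.
by apply: lt_le_trans (Ln x Lx) _; rewrite invS_le// leq_maxr.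
Qed.

(** A countable set A has countably many finite subsets, so Baire's theorem
gives a point y of U in all the dense open sets of dense_tracking_point and
outside A. A finite subset of y |` A is then handled through its trace on A. *)
Lemma tracks_extend (A U : set X) : countable A -> tracks d f c A ->
  open U -> U !=set0 -> exists y, [/\ U y, ~ A y & tracks d f c (y |` A)].
Proof.
move=> cA tA oU U0.
pose O (j : set X * (I * nat)) := [set y | exists2 n, (j.2.2 <= n)%N &
  forall x, (y |` j.1) x -> d (c j.2.1 x) (f n x) < j.2.2.+1%:R^-1].
pose J := [set L | L `<=` A /\ finite_set L] `*` [set: I * nat].
have cJ : countable (O @` J).
  apply: sub_countable (card_image_le _ _) _; apply: countableX => //.
  exact: countable_finite_subset.
have cN : countable ((fun a => ~` [set a]) @` A).
  exact: sub_countable (card_image_le _ _) cA.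
have dJ B : (O @` J) B -> open B /\ dense B.
  move=> [[L [i N]] [[LA L_fin] _] <-]; exact: (dense_tracking_point A L i N).
have dN B : ((fun a => ~` [set a]) @` A) B -> open B /\ dense B.
  by move=> [a _ <-]; exact: dense_setC1.
have [B|y [Uy Gy]] := baire_metric d_metric d_top d_complete
  (countableU cJ cN) _ U U0 oU.
  by move=> [/dJ|/dN].
exists y; split=> // [Ay|i L L_fin LyA N].
  by case: (Gy (~` [set y])) => //; right; exists y.
pose L' := L `\ y.
have L'A : L' `<=` A by move=> x [/LyA[xy /(_ xy)|]].
have [|n Nn nL] := Gy (O (L', (i, N))).
  left; exists (L', (i, N)) => //; split=> //; split=> //.
  exact: finite_setD.
exists n => // x Lx; apply: nL.
by have [->|xy] := pselect (x = y); [left|right].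
Qed.

(** Adds to the empty set, one after the other, a point of each member of a
pi-base. *)
Lemma dense_tracking : exists D : set X,
  [/\ dense D & tracks d f c D].
Proof.
have X0 : [set: X] !=set0 by case: X_two => x _; exists x.
have [B [oB B0 B_base]] := countable_pi_base d_metric d_top X_separable X0.
pose good (A : set X) := countable A /\ tracks d f c A.
have /choice[g gP] (p : nat * set X) : exists A', good p.2 ->
    [/\ good A', p.2 `<=` A' & B p.1 `&` A' !=set0].
  case: p => n A; have [[cA tA]|nA] := pselect (good A); last by exists A.
  have [y [By _ ty]] := tracks_extend _ _ cA tA (oB n) (B0 n).
  exists (y |` A) => _; split.
  - by split=> //; exact: countableU.
  - by move=> x; right.
  - by exists y; split=> //; left.
pose D := fix D n := if n is m.+1 then g (m, D m) else set0.
have D_good n : good (D n).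
  elim: n => [|n IHn]; last by case: (gP (n, D n) IHn).
  by split; [exact: countable0|exact: tracks_set0].
have DS n : D n `<=` D n.+1 by case: (gP (n, D n) (D_good n)).
have D_mono m n : (m <= n)%N -> D m `<=` D n.
  by move=> /subnK <-; elim: (n - m)%N => [//|k IHk] x /IHk; exact: DS.
exists (\bigcup_(A in range D) A); split.
  move=> U U0 oU; have [i BU] := B_base U oU U0.
  have [_ _ [x [Bx Dx]]] := gP (i, D i) (D_good i).
  by exists x; split; [exact: BU|exists (D i.+1) => //; exists i.+1].
rewrite -[X in tracks _ _ _ X]set0U; apply: tracks_chain.
- move=> _ _ [m _ <-] [n _ <-].
  by case/orP: (leq_total m n) => /D_mono; [left|right].
- exact: tracks_set0.
- by move=> _ [n _ <-]; rewrite set0U; case: (D_good n).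
Qed.

(** A tracking set that is maximal among those containing a dense one cannot be
countable, since tracks_extend would enlarge it. *)
Theorem dense_uncountable_tracking :
  exists A : set X, [/\ ~ countable A, dense A & tracks d f c A].
Proof.
have [D [dD tD]] := dense_tracking.
have [F F_sub F_total|A [tA A_max]] :=
    @Zorn_bigcup X [set A | tracks d f c (D `|` A)].
  by apply: tracks_chain => // A /F_sub.
exists (D `|` A); split=> //; last first.
  by move=> U U0 oU; have [x [Ux Dx]] := dD U U0 oU; exists x; split=> //; left.
move=> cA; have [x0 _] := X_two.
have [y [_ DAy ty]] := tracks_extend _ _ cA tA openT (ex_intro _ x0 Logic.I).
apply: (A_max (y |` A)); last by rewrite /= setUCA.
split=> [|yA]; first exact: subsetUr.
by apply: DAy; right; apply: yA; left.
Qed.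

End Tracking.

(** * Hitting times of a weakly mixing semiflow *)

Section WeakMixing.
Context {R : realType} {X : topologicalType} { pi : R -> X -> X}.
Hypotheses (pi_semiflow : C0_semiflow pi) (pi_mixing : weakly_mixing pi).

Lemma semiflow_nbhs {t x V} : 0 <= t -> nbhs (pi t x) V ->
  exists W U, [/\ nbhs t W, nbhs x U &
    forall s y, 0 <= s -> W s -> U y -> V (pi s y)].
Proof.
move=> t0 nV; case: pi_semiflow => /subspace_continuousP pi_cont _ _.
have [[W U] /= [nW nU] sub] := pi_cont (t, x) (conj t0 Logic.I) V nV.
by exists W, U; split=> // s y s0 Ws Uy; apply: (sub (s, y)).
Qed.

Lemma semiflow_continuous {t} : 0 <= t -> continuous (pi t).
Proof.
move=> t0 x V /(semiflow_nbhs t0)[W [U [/nbhs_singleton Wt nU sub]]].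
by apply: filterS nU => y; exact: sub.
Qed.

Lemma open_semiflow_preimage {t V} : 0 <= t -> open V -> open (pi t @^-1` V).
Proof.
by move=> t0 oV; apply: open_comp => // x _; exact: semiflow_continuous.
Qed.

(** Furstenberg's intersection argument. If t is a common hitting time of
(U, U') and (V, V'), then A = U `&` t^-1 U' and B = V `&` t^-1 V' work: if x
lies in A and s x in B, then t x lies in U' and s (t x) = t (s x) in V'. *)
Lemma hitting_times_sub {U V U' V' : set X} :
  open U -> open V -> open U' -> open V' ->
  U !=set0 -> V !=set0 -> U' !=set0 -> V' !=set0 ->
  exists A B, [/\ open A, open B, A !=set0, B !=set0 &
    hitting_times pi A B `<=` hitting_times pi U V `&` hitting_times pi U' V'].
Proof.
move=> oU oV oU' oV' U0 V0 U'0 V'0.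
have [t [[t0 UU'] [_ VV']]] := pi_mixing U U' V V' oU oU' oV oV' U0 U'0 V0 V'0.
exists (U `&` (pi t @^-1` U')), (V `&` (pi t @^-1` V')); split=> //.
- by apply: openI => //; exact: open_semiflow_preimage.
- by apply: openI => //; exact: open_semiflow_preimage.
case: pi_semiflow => _ pi_add _ s [s0 [x [[Ux U'tx] [Vsx V'tsx]]]].
split; split=> //; first by exists x.
by exists (pi t x); split=> //=; rewrite pi_add// addrC -pi_add.
Qed.

Definition hitting_filter : set_system R :=
  [set S | exists U V, [/\ open U, open V, U !=set0, V !=set0 &
    hitting_times pi U V `<=` S]].

Lemma hitting_filter_hitting_times {U V} :
  open U -> open V -> U !=set0 -> V !=set0 ->
  hitting_filter (hitting_times pi U V).
Proof. by move=> oU oV U0 V0; exists U, V; split. Qed.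

Lemma hitting_filter_proper : [set: X] !=set0 -> ProperFilter hitting_filter.
Proof.
move=> X0; apply: Build_ProperFilter_ex.
  move=> S [U [V [oU oV U0 V0 sub]]].
  have [t [ht _]] := pi_mixing U V U V oU oV oU oV U0 V0 U0 V0.
  by exists t; exact: sub.
split.
- by exists setT, setT; split=> //; exact: openT.
- move=> S S' [U [V [oU oV U0 V0 sub]]] [U' [V' [oU' oV' U'0 V'0 sub']]].
  have [A [B [oA oB A0 B0 AB]]] :=
    hitting_times_sub oU oV oU' oV' U0 V0 U'0 V'0.
  by exists A, B; split=> // t /AB[/sub ? /sub' ?].
- by move=> S S' SS' [U [V [? ? ? ? sub]]]; exists U, V; split=> // t /sub/SS'.
Qed.

Context {d : X -> X -> R}.
Hypotheses (d_metric : is_metric d) (d_top : metric_induces_topology d).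
Hypotheses (X_separable : separable X) (X_two : exists x y : X, x <> y).

(** Otherwise the filter has a cluster point t in F. Small neighbourhoods of x
and z then have hitting times close to t, so that t x = z by continuity; this
cannot hold for all z, as X has two points. *)
Lemma hitting_filter_compact {F : set R} :
  F `<=` times R -> compact F -> ~ hitting_filter F.
Proof.
move=> F_times F_compact HF; have [x [y xy]] := X_two.
have H_proper : ProperFilter hitting_filter.
  by apply: hitting_filter_proper; exists x.
have [t [/F_times t0 t_cluster]] := F_compact _ H_proper HF.
suff image_t z : pi t x = z by apply: xy; rewrite -(image_t x) -(image_t y).
case: d_metric => d_ge0 dE dC dT; apply/dE; apply/eqP.
rewrite eq_le d_ge0 andbT leNgt; apply/negP => D0.
pose e := d (pi t x) z / 2; have e0 : 0 < e by rewrite divr_gt0.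
have near_tx : nbhs (pi t x) [set y | d (pi t x) y < e].
  by apply/d_top; exists e.
have [W [U [nW nU WU]]] := semiflow_nbhs t0 near_tx.
rewrite nbhsE in nU; case: nU => U' [oU' U'x] U'U.
have HU := hitting_filter_hitting_times
  oU' (open_metric_ball d_metric d_top z e)
  (ex_intro _ x U'x) (ex_intro _ z (metric_ball_center d_metric z e e0)).
have [s [[s0 [w [/U'U Uw zw]]] Ws]] := t_cluster _ _ HU nW.
have /= xw := WU s w s0 Ws Uw.
have := dT (pi t x) (pi s w) z; rewrite leNgt => /negP; apply.
by rewrite [ltRHS]splitr ltrD// dC.
Qed.

(** Finitely many conditions on t n define a member of the hitting filter, which
is not contained in the compact set F n. *)
Lemma meeting_times (F : nat -> set R) :
  (forall n, F n `<=` times R) -> (forall n, compact (F n)) ->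
  exists t : nat -> R, [/\ forall n, 0 <= t n, forall n, ~ F n (t n) &
    eventually_meeting (fun n => pi (t n))].
Proof.
move=> F_times F_compact.
have X0 : [set: X] !=set0 by case: X_two => x _; exists x.
have H_proper := hitting_filter_proper X0.
have [B [oB B0 B_base]] := countable_pi_base d_metric d_top X_separable X0.
have /choice[t tP] n : exists t, [/\ 0 <= t, ~ F n t &
    forall i j, (i <= n)%N -> (j <= n)%N -> hitting_times pi (B i) (B j) t].
  have HB : hitting_filter [set t | forall p : 'I_n.+1 * 'I_n.+1,
      hitting_times pi (B p.1) (B p.2) t].
    apply: (@filter_forall _ _ (fun p : 'I_n.+1 * 'I_n.+1 =>
      hitting_times pi (B p.1) (B p.2)) hitting_filter _) => p.
    exact: hitting_filter_hitting_times.
  apply: contrapT => no_t.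
  apply: (hitting_filter_compact (F_times n) (F_compact n)).
  apply: filterS HB => t Bt; apply: contrapT => nFt; apply: no_t; exists t.
  split=> //; first by case: (Bt (ord0, ord0)).
  move=> i j; rewrite -ltnS -(ltnS j) => i_n j_n.
  exact: (Bt (Ordinal i_n, Ordinal j_n)).
exists t; split=> [n|n|U V oU oV U0 V0]; [by case: (tP n)..|].
have [i BU] := B_base U oU U0; have [j BV] := B_base V oV V0.
exists (maxn i j) => // n /=; rewrite geq_max => /andP[i_n j_n].
case: (tP n) => _ _ /(_ i j i_n j_n)[_ [x [/BU Ux /BV Vx]]].
by exists x.
Qed.

End WeakMixing.

(** * From tracking to chaos *)

Lemma cvg_ptws {I : eqType} {X : topologicalType} {u : nat -> {ptws I -> X}}
    {l : {ptws I -> X}} :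
  (forall i, (fun n => u n i) @ \oo --> l i) -> u @ \oo --> l.
Proof.
move=> ul; apply/cvg_sup => i; apply/cvg_image.
  apply/seteqP; split=> // y _; exists (fun=> y) => //.
move=> A /ul[N _ NA]; exists ((fun v : {ptws I -> X} => v i) @^-1` A).
  by exists N.
by rewrite image_preimage//; apply/seteqP; split=> // y _; exists (fun=> y).
Qed.

Lemma cvg_of_metric_bound {R : realType} {X : topologicalType} {d : X -> X -> R}
    {u : nat -> X} {l} : metric_induces_topology d ->
  (forall n, d l (u n) < n.+1%:R^-1) -> u @ \oo --> l.
Proof.
move=> d_top ul; apply/(cvg_metricP d_top) => e /invS_lt[N Ne].
exists N => // n /= Nn; apply: lt_trans (ul n) _.
exact: le_lt_trans (invS_le Nn) Ne.
Qed.

Theorem proposition3p10 (R : realType) (X : topologicalType)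
    (pi : R -> X -> X)
    (X_polish : polish R X)
    (X_non_singleton : exists x y : X, x <> y)
    (pi_semiflow : C0_semiflow pi)
    (pi_mixing : weakly_mixing pi) :
  densely_multi_Li_Yorke_chaotic pi.
Proof.
case: X_polish => X_separable [d [d_metric d_top d_complete]].
move=> F F_times F_compact F_incr.
have F_mono m n : (m <= n)%N -> F m `<=` F n.
  by move=> /subnK <-; elim: (n - m)%N => [//|k IHk] t /IHk; exact: F_incr.
have [t [t0 tF t_meet]] := meeting_times pi_semiflow pi_mixing d_metric d_top
  X_separable X_non_singleton F F_times F_compact.
have [p _] := X_non_singleton.
(* The identity gives recurrence, the constant map p the collapse. *)
pose c (b : bool) : X -> X := if b then id else fun=> p.
have c_cont b : continuous (c b).
  by case: b => x; [exact: cvg_id|exact: cvg_cst].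
have [A [A_unc A_dense A_tracks]] :=
  dense_uncountable_tracking d_metric d_top d_complete X_separable
    X_non_singleton (fun n => semiflow_continuous pi_semiflow (t0 n))
    c_cont t_meet.
exists A; split=> // k x _ _ Ax.
(* The index u n is at least n, so that t (u n) avoids F (u n), hence F n. *)
have near_times b : exists u : nat -> nat, forall n, (n <= u n)%N /\
    forall i, d (c b (x i)) (pi (t (u n)) (x i)) < n.+1%:R^-1.
  suff /choice[u uP] n : exists m, (n <= m)%N /\
      forall i, d (c b (x i)) (pi (t m) (x i)) < n.+1%:R^-1 by exists u.
  have [||m nm mx] := A_tracks b (range x) _ _ n.
  - exact: finite_image.
  - by move=> _ [i _ <-].
  - by exists m; split=> // i; apply: mx; exists i.
have [u uP] := near_times true; have [v vP] := near_times false.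
exists (t \o u), (t \o v), p; split.
- move=> n; split; first exact: t0.
  by move=> Fs; apply: (tF (u n)); apply: F_mono Fs; case: (uP n).
- by move=> n; exact: t0.
- apply: cvg_ptws => i; apply: (cvg_of_metric_bound d_top) => n.
  by case: (uP n) => _ /(_ i).
- apply: cvg_ptws => i; apply: (cvg_of_metric_bound d_top) => n.
  by case: (vP n) => _ /(_ i).
Qed.
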